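(* Let $\mathcal V$ be a subvariety of $\mathcal A$. The following conditions are equivalent: (i) $TR_6\notin\mathcal V$; (ii) $\mathcal V$ satisfies the identity $x_1x_2+x_2x_3+x_3x_4\approx x_1x_2+x_2x_3+x_3x_4+x_1x_4$; (iii) $\mathcal V$ is hereditarily finitely based. Moreover, the subvariety lattice of $\mathcal K$ is finite, and every subvariety of $\mathcal K$ has a finite equational basis involving at most ten variables. Finally, $\mathsf V(TR_6)$ is the unique limit subvariety of $\mathcal A$, and it is also the unique limit subvariety of $\mathcal M$.
   Context: An additively idempotent semiring (ai-semiring) is an algebra $(S,+,\cdot)$ of signature $(2,2)$, without constants, such that $(S,+)$ is a commutative idempotent semigroup, $(S,\cdot)$ is a semigroup, and multiplication distributes over addition on both sides. It is commutative if its multiplication is commutative. All varieties are in the signature $(2,2)$; $\mathsf V(S)$ is the variety generated by $S$, and $\leq$ between varieties is inclusion. A variety is finitely based if it can be defined by finitely many identities; it is hereditarily finitely based if each of its subvarieties is finitely based; a limit variety is a nonfinitely based variety all of whose proper subvarieties are finitely based. $\mathbf N$ is the ai-semiring on the nonnegative integers $\mathbb N_0$ whose semiring addition is $\max$ and whose semiring multiplication is numerical addition; $\mathcal M=\mathsf V(\mathbf N)$. $\mathcal A$ is the variety of commutative ai-semirings defined by $xy+x\approx xy$ and $x^2+y^2+xy\approx x^2+y^2$ (one has $\mathcal M\leq\mathcal A$). $\mathcal K$ is the subvariety of $\mathcal A$ defined by $x_1x_2+x_2x_3+x_3x_4\approx x_1x_2+x_2x_3+x_3x_4+x_1x_4$.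 $TR_6$ is the commutative ai-semiring with universe $\{1,2,3,4,5,6\}$ and the following operations. Addition is the join operation of the partial order (where $a\le b$ means $a+b=b$) in which $1$ is the greatest element, $3$ is the next one below $1$, all of $2,4,5,6$ lie below $3$, and the only further strict relations are $5<2$ and $6<4$; explicitly $2+5=2$, $4+6=4$, $1+a=1$ for all $a$, $3+a=3$ for all $a\neq1$, and any two distinct elements of $\{2,4,5,6\}$ other than the pairs $\{2,5\}$, $\{4,6\}$ have sum $3$. Multiplication is commutative with $2\cdot6=5\cdot6=4\cdot5=3$ and all other products equal to $1$. *)

(* Defs.v *)
From mathcomp Require Import all_boot.
From mathcomp Require Import boolp classical_sets functions cardinality.

Set Implicit Arguments.
Unset Strict Implicit.
Unset Printing Implicit Defensive.

Local Open Scope classical_set_scope.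

Record algebra : Type := Algebra {
  carrier :> Type;
  alg_add : carrier -> carrier -> carrier;
  alg_mul : carrier -> carrier -> carrier;
  alg_nonempty : inhabited carrier }.

Definition ai_semiring (S : algebra) : Prop :=
  [/\ [/\ associative (@alg_add S), commutative (@alg_add S)
        & idempotent_op (@alg_add S)],
      associative (@alg_mul S),
      left_distributive (@alg_mul S) (@alg_add S)
    & right_distributive (@alg_mul S) (@alg_add S)].

Definition commutative_ai_semiring (S : algebra) : Prop :=
  ai_semiring S /\ commutative (@alg_mul S).

Definition homomorphism (S T : algebra) (f : S -> T) : Prop :=
  {morph f : x y / alg_add x y >-> alg_add x y} /\
  {morph f : x y / alg_mul x y >-> alg_mul x y}.

(* The choice of points in the factors only serves to show that the product
   is nonempty. *)
Definition direct_product (I : Type) (S : I -> algebra) : algebra :=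
  @Algebra (forall i, S i)
    (fun x y i => alg_add (x i) (y i))
    (fun x y i => alg_mul (x i) (y i))
    (inhabits (fun i => inhabited_witness (alg_nonempty (S i)))).

(* Subalgebras are taken up to isomorphism, as domains of injective
   homomorphisms. *)
Definition variety (V : set algebra) : Prop :=
  [/\ forall (S T : algebra) (f : S -> T),
        homomorphism f -> set_surj setT setT f -> V S -> V T,
      forall (S T : algebra) (f : S -> T),
        homomorphism f -> injective f -> V T -> V S
    & forall (I : Type) (S : I -> algebra),
        (forall i, V (S i)) -> V (direct_product S)].

Definition generated_variety (S : algebra) : set algebra :=
  smallest variety [set S].

Definition subvariety (W V : set algebra) : Prop := variety W /\ W `<=` V.

Inductive term : Type :=
  | Var of nat
  | Add of term & term
  | Mul of term & term.

Declare Scope term_scope.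
Delimit Scope term_scope with T.
Bind Scope term_scope with term.
Notation "''x_' i" := (Var i) (at level 8, i at level 2, format "''x_' i")
  : term_scope.
Notation "s + t" := (Add s t) : term_scope.
Notation "s * t" := (Mul s t) : term_scope.

Definition identity : Type := (term * term)%type.

Notation "s ≈ t" := ((s%T, t%T) : identity) (at level 70, no associativity).

Fixpoint eval (S : algebra) (v : nat -> S) (t : term) : S :=
  match t with
  | Var i => v i
  | Add t1 t2 => alg_add (eval v t1) (eval v t2)
  | Mul t1 t2 => alg_mul (eval v t1) (eval v t2)
  end.

Definition satisfies (S : algebra) (e : identity) : Prop :=
  forall v : nat -> S, eval v e.1 = eval v e.2.

Definition class_satisfies (V : set algebra) (e : identity) : Prop :=
  forall S, V S -> satisfies S e.

Definition models (E : set identity) : set algebra :=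
  [set S | forall e, E e -> satisfies S e].

Fixpoint term_vars (t : term) : set nat :=
  match t with
  | Var i => [set i]
  | Add t1 t2 | Mul t1 t2 => term_vars t1 `|` term_vars t2
  end.

Definition vars (E : set identity) : set nat :=
  \bigcup_(e in E) (term_vars e.1 `|` term_vars e.2).

Definition finite_basis (V : set algebra) (E : set identity) : Prop :=
  finite_set E /\ V = models E.

Definition finitely_based (V : set algebra) : Prop :=
  exists E, finite_basis V E.

Definition hereditarily_finitely_based (V : set algebra) : Prop :=
  forall W, subvariety W V -> finitely_based W.

Definition limit_variety (V : set algebra) : Prop :=
  [/\ variety V, ~ finitely_based V
    & forall W, subvariety W V -> W <> V -> finitely_based W].

Definition unique_limit_subvariety (V W : set algebra) : Prop :=
  forall U, (subvariety U V /\ limit_variety U) <-> U = W.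

Definition N_max_plus : algebra := @Algebra nat maxn addn (inhabits 0).

Definition variety_M : set algebra := generated_variety N_max_plus.

Definition variety_A : set algebra :=
  [set S | [/\ commutative_ai_semiring S,
     satisfies S ('x_0 * 'x_1 + 'x_0 ≈ 'x_0 * 'x_1)
   & satisfies S ('x_0 * 'x_0 + 'x_1 * 'x_1 + 'x_0 * 'x_1
                    ≈ 'x_0 * 'x_0 + 'x_1 * 'x_1)]].

Definition K_identity : identity :=
  'x_1 * 'x_2 + 'x_2 * 'x_3 + 'x_3 * 'x_4
    ≈ 'x_1 * 'x_2 + 'x_2 * 'x_3 + 'x_3 * 'x_4 + 'x_1 * 'x_4.

Definition variety_K : set algebra :=
  variety_A `&` [set S | satisfies S K_identity].

Inductive TR6_carrier : Type := e1 | e2 | e3 | e4 | e5 | e6.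

Definition TR6_add (a b : TR6_carrier) : TR6_carrier :=
  match a, b with
  | e1, _ | _, e1 => e1
  | e3, _ | _, e3 => e3
  | e2, e2 | e2, e5 | e5, e2 => e2
  | e4, e4 | e4, e6 | e6, e4 => e4
  | e5, e5 => e5
  | e6, e6 => e6
  | _, _ => e3
  end.

Definition TR6_mul (a b : TR6_carrier) : TR6_carrier :=
  match a, b with
  | e2, e6 | e6, e2 | e5, e6 | e6, e5 | e4, e5 | e5, e4 => e3
  | _, _ => e1
  end.

Definition TR6 : algebra := @Algebra TR6_carrier TR6_add TR6_mul (inhabits e1).

(* Main.v *)
Require Import Defs.
From mathcomp Require Import all_boot.
From mathcomp Require Import boolp classical_sets functions cardinality.

Set Implicit Arguments.
Unset Strict Implicit.
Unset Printing Implicit Defensive.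

Local Open Scope classical_set_scope.

(** Identities are read as inequalities: writing x <= y for x + y = y, a term is
    the join of its words, so an identity says that every word of either side
    lies below the other side.  By Birkhoff's theorem ([birkhoff]) membership in
    a variety is a question about such inequalities.

    The identity of K holds when TR6 is absent ([K_of_not_TR6]).  In TR6 the
    elements 4, 5, 6, 2 form a path whose consecutive products are 3, all
    other products are 1, and 1 is the top.  Apart from degenerate cases, an
    inequality of V that fails in TR6 therefore bounds a product of two elements
    that are not consecutive on the path.  Substituting into it paths of elements of a member of V,
    including walks back and forth along one edge, bounds the product of the
    two ends of every path, which is the identity of K.

    Inside K two facts make everything finite.  A word of length at least three
    is the sum of the cubes of its letters ([long_le]), so that only the words
    x, xy and xxx matter.  At a fixed valuation and below a fixed bound, the
    pairs of variables with product below the bound form a graph whose walks of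
    length three close up: its components are complete bipartite, except for at
    most one with loops, which is complete.  Such a graph has an endomorphism
    with at most ten vertices in its image that fixes two given vertices
    ([fold_graph]).  Hence every identity is equivalent in K to identities in
    ten variables ([subvariety_K_basis]), of which there are finitely many
    up to equality in K.

    V(TR6) is not finitely based ([TR6_not_finitely_based]).  The sum of the
    edges of an odd cycle has value 1 in TR6, as the products other than 1 form
    a bipartite graph.  The sums of vertices and edges of a long odd cycle, with
    everything else collapsed to a top element, form an algebra in which the sum
    of all edges is not the top; yet it satisfies every identity of TR6 in few
    variables, because few vertices of a long cycle span a bipartite graph.

    These facts combine as follows.  A subvariety of A is hereditarily finitely
    based exactly when it omits TR6, so V(TR6) is a limit variety, and a limit
    subvariety of A contains TR6 and hence equals V(TR6).  The variety M lies in
    A and violates the identity of K, so it contains TR6. *)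

(** * Varieties and Birkhoff's theorem *)

Lemma eval_hom (S T : algebra) (f : S -> T) : homomorphism f ->
  forall (v : nat -> S) t, f (eval v t) = eval (f \o v) t.
Proof. by case=> fD fM v; elim=> //= s <- t <-. Qed.

Lemma eval_prod (I : Type) (S : I -> algebra) (v : nat -> direct_product S) t i :
  eval v t i = eval (fun n => v n i) t.
Proof. by elim: t => //= s -> t ->. Qed.

Lemma variety_models (E : set identity) : variety (models E).
Proof.
split=> [S T f fH fS mS e Ee v|S T f fH fI mT e Ee v|I S mS e Ee v].
- have [g gK] : exists g : T -> S, forall y, f (g y) = y.
    suff /choice[g gK] : forall y, exists x, f x = y by exists g.
    by move=> y; have [x _ <-] := fS y I; exists x.
  have -> : v = f \o (g \o v) by apply/funext => n /=.
  by rewrite -!(eval_hom fH) (mS e Ee).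
- by apply: fI; rewrite !(eval_hom fH) (mT e Ee).
- by apply/functional_extensionality_dep => i; rewrite !eval_prod (mS i e Ee).
Qed.

Lemma variety_generated (S : algebra) : variety (generated_variety S).
Proof.
split=> [A B f fH fS VA M|A B f fH fI VB M|I F VF M] [vM SM].
- by case: (vM) => h _ _; apply: h fH fS _; apply: VA.
- by case: (vM) => _ h _; apply: h fH fI _; apply: VB.
- by case: (vM) => _ _; apply=> i; apply: VF.
Qed.

Lemma mem_generated (S : algebra) : generated_variety S S.
Proof. exact: (@sub_gen_smallest _ variety [set S]). Qed.

Lemma generated_sub (S : algebra) (V : set algebra) :
  variety V -> V S -> generated_variety S `<=` V.
Proof. by move=> vV VS; apply: smallest_sub => // _ ->. Qed.

Lemma generated_satisfies (S : algebra) e :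
  satisfies S e -> class_satisfies (generated_variety S) e.
Proof.
move=> Se T VT.
suff h : generated_variety S `<=` models [set e] by exact: (h T VT e).
by apply: generated_sub; [exact: variety_models|move=> _ ->].
Qed.

(** Terms over an arbitrary alphabet: the free algebra that maps onto a given
    algebra may need more generators than the countably many variables. *)
Inductive xterm (X : Type) : Type :=
  | XVar of X
  | XAdd of xterm X & xterm X
  | XMul of xterm X & xterm X.

Fixpoint xeval (X : Type) (S : algebra) (v : X -> S) (t : xterm X) : S :=
  match t with
  | XVar x => v x
  | XAdd s t => alg_add (xeval v s) (xeval v t)
  | XMul s t => alg_mul (xeval v s) (xeval v t)
  end.

Lemma xeval_prod X (I : Type) (S : I -> algebra) (v : X -> direct_product S) t i :
  xeval v t i = xeval (fun n => v n i) t.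
Proof. by elim: t => //= s -> t ->. Qed.

(** Finitely many letters occur in a term, so they can be numbered. *)
Lemma xterm_numbering (X : Type) (x0 : X) (s t : xterm X) :
  exists (c : X -> nat) (d : nat -> X) (s' t' : term),
    forall (S : algebra),
      (forall v : X -> S, xeval v s = eval (v \o d) s' /\
                          xeval v t = eval (v \o d) t') /\
      (forall w : nat -> S, eval w s' = xeval (w \o c) s /\
                            eval w t' = xeval (w \o c) t).
Proof.
pose c (l : seq {classic X}) x := index (x : {classic X}) l.
pose fix num l (u : xterm X) := match u with
  | XVar x => Var (c l x) | XAdd a b => Add (num l a) (num l b)
  | XMul a b => Mul (num l a) (num l b) end.
pose fix xletters (u : xterm X) : seq {classic X} := match u with
  | XVar x => [:: x : {classic X}] | XAdd a b | XMul a b => xletters a ++ xletters b end.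
have numw (l : seq {classic X}) u (S : algebra) (w : nat -> S) :
    eval w (num l u) = xeval (w \o c l) u.
  by elim: u => //= a -> b ->.
pose l := xletters s ++ xletters t; pose d n := nth (x0 : {classic X}) l n.
have numv u (S : algebra) (v : X -> S) : {subset xletters u <= l} ->
    xeval v u = eval (v \o d) (num l u).
  elim: u => [x|a IHa b IHb|a IHa b IHb] /= ul.
  - by rewrite /d nth_index // ul // mem_head.
  - by rewrite IHa ?IHb // => y yl; apply: ul; rewrite mem_cat yl ?orbT.
  - by rewrite IHa ?IHb // => y yl; apply: ul; rewrite mem_cat yl ?orbT.
exists (c l), d, (num l s), (num l t) => S; split=> [v|w]; last by rewrite !numw.
by split; apply: numv => y yl; rewrite mem_cat yl ?orbT.
Qed.

(** Birkhoff's theorem.  Each pair of terms over the carrier of [S] that is not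
    an identity of [V] is separated in some member of [V]; the product of
    these members contains a free algebra of [V], which maps onto [S]. *)
Lemma birkhoff (V : set algebra) (S : algebra) : variety V ->
  (forall e, class_satisfies V e -> satisfies S e) -> V S.
Proof.
move=> [VH VS VP] Sid; have [x0] := alg_nonempty S.
pose holds (s t : xterm S) :=
  forall T : algebra, V T -> forall v : S -> T, xeval v s = xeval v t.
have holdsS s t : holds s t -> xeval id s = xeval id t.
  move=> st; have [c [d [s' [t' h]]]] := xterm_numbering x0 s t.
  have [/(_ id)[-> ->] _] := h S.
  apply: (Sid (s', t')) => T VT v /=.
  by have [_ /(_ v)[-> ->]] := h T; apply: st.
pose J := {st : xterm S * xterm S | ~ holds st.1 st.2}.
have /choice[F FP] (j : J) : exists T : {T : algebra & S -> T}, V (projT1 T) /\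
    xeval (projT2 T) (sval j).1 <> xeval (projT2 T) (sval j).2.
  case: j => -[s t] /= /existsNP[T] /not_implyP[VT] /existsNP[v nv].
  by exists (existT _ T v).
pose P := direct_product (fun j => projT1 (F j)).
have {}VP : V P by apply: VP => j; case: (FP j).
pose g : S -> P := fun x j => projT2 (F j) x.
have gsep s t : xeval g s = xeval g t -> xeval id s = xeval id t.
  move=> gst; apply: holdsS; apply: contrapT => nst.
  pose j : J := exist _ (s, t) nst; have [_ /=] := FP j; apply.
  by rewrite -!(xeval_prod g) gst.
pose C := {p : P | exists t, xeval g t = p}.
pose Cadd (p q : C) : C := exist _ (alg_add (sval p) (sval q))
  (match svalP p, svalP q with ex_intro s es, ex_intro t et =>
    ex_intro _ (XAdd s t) (f_equal2 (@alg_add P) es et) end).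
pose Cmul (p q : C) : C := exist _ (alg_mul (sval p) (sval q))
  (match svalP p, svalP q with ex_intro s es, ex_intro t et =>
    ex_intro _ (XMul s t) (f_equal2 (@alg_mul P) es et) end).
pose Fr := @Algebra C Cadd Cmul
  (inhabits (exist _ (g x0) (ex_intro _ (XVar x0) erefl))).
have VFr : V Fr.
  by apply: (VS Fr P sval) => // -[p hp] [q hq] /= pq; apply: eq_exist.
have /choice[tm tmE] (p : Fr) : exists t, xeval g t = sval p by case: p.
apply: (VH Fr S (fun p => xeval id (tm p))) => //.
  by split=> p q /=;
    [apply: (gsep _ (XAdd _ _))|apply: (gsep _ (XMul _ _))]; rewrite /= !tmE.
move=> x _; exists (exist _ (g x) (ex_intro _ (XVar x) erefl)) => //.
by apply: (gsep _ (XVar x)); rewrite tmE.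
Qed.

(** * Terms as sums of words *)

Definition le (S : algebra) (x y : S) : Prop := alg_add x y = y.

(** A word is a nonempty sequence of variables; the value of the empty
    sequence is a junk value. *)
Fixpoint evalw (S : algebra) (v : nat -> S) (p : seq nat) : S :=
  match p with
  | [::] => v 0
  | [:: x] => v x
  | x :: q => alg_mul (v x) (evalw v q)
  end.

Fixpoint words (t : term) : seq (seq nat) :=
  match t with
  | Var i => [:: [:: i]]
  | Add s t => words s ++ words t
  | Mul s t => [seq p ++ q | p <- words s, q <- words t]
  end.

Fixpoint wterm (p : seq nat) : term :=
  match p with
  | [::] => Var 0
  | [:: x] => Var x
  | x :: q => Mul (Var x) (wterm q)
  end.

Definition entails_le (V : set algebra) (p : seq nat) (s : term) : Prop :=
  forall S, V S -> forall v : nat -> S, le (evalw v p) (eval v s).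

Lemma eval_wterm (S : algebra) (v : nat -> S) p : eval v (wterm p) = evalw v p.
Proof. by elim: p => [|x [|y q] IH] //=; congr alg_mul; apply: IH. Qed.

Lemma evalw_cons (S : algebra) (v : nat -> S) x p : p <> [::] ->
  evalw v (x :: p) = alg_mul (v x) (evalw v p).
Proof. by case: p. Qed.

Lemma words_neq_nil t p : p \in words t -> p <> [::].
Proof.
elim: t p => [i|s IHs t IHt|s IHs t IHt] p /=.
- by rewrite inE => /eqP->.
- by rewrite mem_cat => /orP[/IHs|/IHt].
- by move=> /allpairsP[[q r] /= [/IHs + _ ->]]; case: q.
Qed.

Lemma words_neq0 t : exists p, p \in words t.
Proof.
elim: t => [i|s [p ps] t _|s [p ps] t [q qt]] /=.
- by exists [:: i]; rewrite inE.
- by exists p; rewrite mem_cat ps.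
- by exists (p ++ q); apply/allpairsP; exists (p, q).
Qed.

Section CommutativeSemiring.
Variable S : algebra.
Hypothesis comS : commutative_ai_semiring S.

Local Notation "x ⊕ y" := (@alg_add S x y) (at level 50, left associativity).
Local Notation "x ⊗ y" := (@alg_mul S x y) (at level 40, left associativity).
Local Notation "x ≼ y" := (@le S x y) (at level 70, no associativity).

Implicit Types (x y z : S) (v : nat -> S).

Lemma addsA : associative (@alg_add S). Proof. by case: comS => -[[]]. Qed.
Lemma addsC : commutative (@alg_add S). Proof. by case: comS => -[[]]. Qed.
Lemma addss x : x ⊕ x = x. Proof. by case: comS => -[[_ _ h] _ _ _] _; apply: h. Qed.
Lemma mulsA : associative (@alg_mul S). Proof. by case: comS => -[]. Qed.
Lemma mulsC : commutative (@alg_mul S). Proof. by case: comS. Qed.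
Lemma mulsDl x y z : (x ⊕ y) ⊗ z = x ⊗ z ⊕ y ⊗ z.
Proof. by case: comS => -[_ _ h _] _; apply: h. Qed.
Lemma mulsDr x y z : x ⊗ (y ⊕ z) = x ⊗ y ⊕ x ⊗ z.
Proof. by case: comS => -[_ _ _ h] _; apply: h. Qed.
Lemma mulsCA x y z : x ⊗ (y ⊗ z) = y ⊗ (x ⊗ z).
Proof. by rewrite mulsA (mulsC x) -mulsA. Qed.

Lemma le_refl x : x ≼ x. Proof. exact: addss. Qed.
Lemma le_trans y x z : x ≼ y -> y ≼ z -> x ≼ z.
Proof. by rewrite /le => xy <-; rewrite addsA xy. Qed.
Lemma le_anti x y : x ≼ y -> y ≼ x -> x = y.
Proof. by move=> xy yx; rewrite -[LHS]yx addsC. Qed.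
Lemma le_addl x y : x ≼ x ⊕ y. Proof. by rewrite /le addsA addss. Qed.
Lemma le_addr x y : y ≼ x ⊕ y. Proof. by rewrite addsC; apply: le_addl. Qed.
Lemma add_le x y z : x ⊕ y ≼ z <-> x ≼ z /\ y ≼ z.
Proof.
split=> [h|[xz yz]]; last by rewrite /le -addsA yz.
by split; apply: le_trans h; [apply: le_addl|apply: le_addr].
Qed.
Lemma eq_le x y : (forall z, x ≼ z <-> y ≼ z) -> x = y.
Proof. by move=> h; apply: le_anti; apply/h; apply: le_refl. Qed.

Lemma le_mul2 x x' y y' : x ≼ x' -> y ≼ y' -> x ⊗ y ≼ x' ⊗ y'.
Proof.
move=> xx yy; apply: (@le_trans (x' ⊗ y)).
- by rewrite /le -mulsDl xx.
- by rewrite /le -mulsDr yy.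
Qed.

Lemma evalw_cat v p q : p <> [::] -> q <> [::] ->
  evalw v (p ++ q) = evalw v p ⊗ evalw v q.
Proof.
move=> + qn; elim: p => // x p IH _; case: p IH => [|y p] IH.
  by rewrite cat1s evalw_cons.
by rewrite cat_cons evalw_cons // IH // mulsA -evalw_cons.
Qed.

(** The distributive laws turn a bound on a product by [b] into bounds on its
    words, since multiplication by [b] preserves sums. *)
Lemma eval_mul_le v t b z :
  eval v t ⊗ b ≼ z <-> forall p, p \in words t -> evalw v p ⊗ b ≼ z.
Proof.
elim: t b z => [i|s IHs t IHt|s IHs t IHt] b z /=.
- split=> [h p|/(_ [:: i])]; first by rewrite inE => /eqP->.
  by apply; rewrite inE.
- rewrite mulsDl add_le IHs IHt; split=> [[hs ht] p|h].
    by rewrite mem_cat => /orP[/hs|/ht].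
  by split=> p ps; apply: h; rewrite mem_cat ps ?orbT.
- rewrite -mulsA IHs; split=> [h p /allpairsP[[q r] /= [qs rt ->]]|h q qs].
    rewrite evalw_cat; [|exact: words_neq_nil qs|exact: words_neq_nil rt].
    by have:= h q qs; rewrite mulsCA IHt => /(_ r rt); rewrite mulsCA mulsA.
  rewrite mulsCA IHt => r rt; rewrite mulsCA mulsA -evalw_cat;
    [|exact: words_neq_nil qs|exact: words_neq_nil rt].
  by apply: h; apply/allpairsP; exists (q, r).
Qed.

Lemma eval_le v t z :
  eval v t ≼ z <-> forall p, p \in words t -> evalw v p ≼ z.
Proof.
elim: t z => [i|s IHs t IHt|s IHs t IHt] z /=.
- split=> [h p|/(_ [:: i])]; first by rewrite inE => /eqP->.
  by apply; rewrite inE.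
- rewrite add_le IHs IHt; split=> [[hs ht] p|h].
    by rewrite mem_cat => /orP[/hs|/ht].
  by split=> p ps; apply: h; rewrite mem_cat ps ?orbT.
- rewrite eval_mul_le; split=> [h p /allpairsP[[q r] /= [qs rt ->]]|h q qs].
    rewrite evalw_cat; [|exact: words_neq_nil qs|exact: words_neq_nil rt].
    by have:= h q qs; rewrite mulsC eval_mul_le => /(_ r rt); rewrite mulsC.
  rewrite mulsC eval_mul_le => r rt; rewrite mulsC -evalw_cat;
    [|exact: words_neq_nil qs|exact: words_neq_nil rt].
  by apply: h; apply/allpairsP; exists (q, r).
Qed.

Lemma evalw_le_eval v t p : p \in words t -> evalw v p ≼ eval v t.
Proof. by move: p; apply/eval_le; apply: le_refl. Qed.

Lemma satisfies_add_wterm s p :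
  satisfies S (Add s (wterm p), s) <-> forall v, evalw v p ≼ eval v s.
Proof.
by split=> h v; have := h v; rewrite /le /= eval_wterm addsC.
Qed.

End CommutativeSemiring.

(** Together with [satisfies_of_le] this replaces identities by inequalities
    whose left side is a single word, the form in which they are used. *)
Lemma class_satisfies_le (V : set algebra) s t : V `<=` commutative_ai_semiring ->
  class_satisfies V (s, t) -> forall p, p \in words t -> entails_le V p s.
Proof.
move=> VC st p pt S VS v; have /= -> := st S VS v.
exact: evalw_le_eval (VC _ VS) _ _ _ pt.
Qed.

Lemma satisfies_of_le (S : algebra) s t : commutative_ai_semiring S ->
  (forall v : nat -> S, forall p, p \in words t -> le (evalw v p) (eval v s)) ->
  (forall v : nat -> S, forall p, p \in words s -> le (evalw v p) (eval v t)) ->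
  satisfies S (s, t).
Proof.
by move=> CS hts hst v; apply: (le_anti CS); apply/(eval_le CS);
  [apply: hst|apply: hts].
Qed.

(** * The variety A *)

Section VarietyA.
Variable S : algebra.
Hypothesis AS : variety_A S.

Local Notation "x ⊕ y" := (@alg_add S x y) (at level 50, left associativity).
Local Notation "x ⊗ y" := (@alg_mul S x y) (at level 40, left associativity).
Local Notation "x ≼ y" := (@le S x y) (at level 70, no associativity).

Implicit Types (x y z : S) (v : nat -> S).

Lemma A_com : commutative_ai_semiring S. Proof. by case: AS. Qed.
Let CS := A_com.

Lemma le_mull x y : x ≼ x ⊗ y.
Proof.
case: AS => _ h _; have /= := h (fun n => if n == 0 then x else y).
by rewrite (addsC CS).
Qed.

Lemma le_mulr x y : y ≼ x ⊗ y.
Proof. by rewrite (mulsC CS); apply: le_mull. Qed.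

Lemma mul_le_sqr x y z : x ⊗ x ≼ z -> y ⊗ y ≼ z -> x ⊗ y ≼ z.
Proof.
case: AS => _ _ h xz yz; have /= := h (fun n => if n == 0 then x else y).
move=> e; have : x ⊗ x ⊕ y ⊗ y ≼ z by apply/(add_le CS).
by rewrite -e => /(add_le CS)[].
Qed.

Lemma letter_le v (p : seq nat) i : i \in p -> v i ≼ evalw v p.
Proof.
elim: p => // y p IH; rewrite inE => /orP[/eqP->|ip].
  by case: p IH => [|z p] IH; [apply: (le_refl CS)|apply: le_mull].
rewrite evalw_cons; last by move=> p0; rewrite p0 in ip.
by apply: (le_trans CS (IH ip)); apply: le_mulr.
Qed.

Lemma pair_le v i (p : seq nat) j : j \in p -> v i ⊗ v j ≼ evalw v (i :: p).
Proof.
move=> jp; rewrite evalw_cons; last by move=> p0; rewrite p0 in jp.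
by apply: (le_mul2 CS); [apply: (le_refl CS)|apply: letter_le].
Qed.

End VarietyA.

(** * Folding graphs in which walks of length three close up *)

Lemma head_in (s : seq nat) d e : e \in s -> head d s \in s.
Proof. by case: s => // x s _; apply: mem_head. Qed.

(** The hypotheses make each connected component complete bipartite, except
    for at most one complete component that carries all the loops.  Hence a
    vertex can be moved to any vertex with which it shares a neighbour, and a
    whole bipartite component onto the two ends of a single edge: the image
    consists of the given vertices [a] and [b], one neighbour of each, one
    looped vertex, one edge, and one vertex that receives the isolated ones. *)
Lemma fold_graph (R : rel nat) (V : seq nat) (a b : nat) :
  symmetric R ->
  (forall x y z t, R x y -> R y z -> R z t -> R x t) ->
  (forall x y, R x x -> R y y -> R x y) ->
  exists (f : nat -> nat) (L : seq nat),
  [/\ size L <= 10, forall x, f x \in L, f a = a, f b = b &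
   {in V &, forall x y, R x y -> R (f x) (f y)} /\
   {in V, forall x, f x \in V \/ exists u, R (f x) u}].
Proof.
move=> Rsym Rpath Rloop.
pose N x := [seq y <- V | R x y].
(* The default value [x] makes the neighbour chosen for an isolated [a] or [b]
   equal to [a] or [b], so that it brings no new component into [L0]. *)
pose m x := head x (N x).
pose twin x y := has (fun u => R x u && R y u) V.
pose l := head a [seq y <- V | R y y].
pose o := head a V.
pose e := head a [seq y <- V | N y != [::]].
pose L0 := [:: a; b; m a; m b; l].
pose touched x := (x \in [:: a; b]) || has (twin x) L0.
(* [m x] and [m (m x)] are the canonical vertices of the two sides of the
   component of [x]; their order tells on which side [x] lies. *)
pose color x := m x < m (m x).
pose f x := if x == a then a else if x == b then b else
  if has (twin x) L0 then head o [seq y <- L0 | twin x y] else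
  if N x == [::] then o else if color x then e else m e.
have mN x y : R x y -> y \in V -> m x \in N x.
  by move=> xy yV; apply: (@head_in _ _ y); rewrite mem_filter xy.
have Rm x y : R x y -> y \in V -> R x (m x) /\ m x \in V.
  by move=> xy yV; have := mN x y xy yV; rewrite mem_filter => /andP.
have twinR x y u : twin x y -> R x u -> R y u.
  case/hasP=> t _ /andP[xt yt] xu.
  by apply: (Rpath y t x u) => //; rewrite Rsym.
have twinN x y : twin x y -> N x = N y.
  move=> xy; apply: eq_filter => u; apply/idP/idP; first exact: twinR.
  by apply: twinR; case/hasP: xy => t tV /andP[xt yt]; apply/hasP; exists t => //;
    apply/andP.
have twin_of x y u : u \in V -> R x u -> R y u -> twin x y.
  by move=> uV xu yu; apply/hasP; exists u => //; apply/andP.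
have loopP q : q \in V -> R q q -> R l l /\ l \in V.
  move=> qV qq; have : l \in [seq y <- V | R y y].
    by apply: (@head_in _ _ q); rewrite mem_filter qq.
  by rewrite mem_filter => /andP.
have touchedE x y : touched x -> R x y -> y \in V ->
    exists2 k, k \in L0 & twin x k.
  move=> + xy yV => /orP[x_ab|/hasP[k kL xk]]; last by exists k.
  exists x; last exact: (twin_of _ _ y).
  by move: x_ab; rewrite !inE => /orP[->|->]; rewrite ?orbT.
have touched_f x y u : touched x -> R x y -> y \in V -> R x u -> R (f x) u.
  move=> tx xy yV xu; rewrite /f; case: eqP => [<- //|_]; case: eqP => [<- //|_].
  have [k kL xk] := touchedE x y tx xy yV.
  have -> : has (twin x) L0 by apply/hasP; exists k.
  have : head o [seq y <- L0 | twin x y] \in [seq y <- L0 | twin x y].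
    by apply: (@head_in _ _ k); rewrite mem_filter xk.
  by rewrite mem_filter => /andP[h _]; apply: (twinR x).
have L0P k : k \in L0 ->
    k \in [:: a; b] \/ (exists2 c, c \in [:: a; b] & R c k) \/ R k k.
  have mP c : m c = c \/ R c (m c).
    rewrite /m; case E : (N c) => [|q s]; [by left|right].
    have : q \in N c by rewrite E mem_head.
    by rewrite mem_filter => /andP[].
  have lP : l = a \/ R l l.
    rewrite /l; case E : [seq y <- V | R y y] => [|q s]; [by left|right].
    have : q \in [seq y <- V | R y y] by rewrite E mem_head.
    by rewrite mem_filter => /andP[].
  have aab : a \in [:: a; b] by rewrite !inE eqxx.
  have bab : b \in [:: a; b] by rewrite !inE eqxx orbT.
  rewrite [k \in L0]inE => /predU1P[->|]; first by left.
  rewrite inE => /predU1P[->|]; first by left.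
  rewrite inE => /predU1P[->|].
    by case: (mP a) => [->|h]; [left|right; left; exists a].
  rewrite inE => /predU1P[->|].
    by case: (mP b) => [->|h]; [left|right; left; exists b].
  by rewrite inE => /eqP->; case: lP => [->|h]; [left|right; right].
have touched_nbr x y : touched x -> R x y -> x \in V -> y \in V -> touched y.
  move=> tx xy xV yV; have [k kL xk] := touchedE x y tx xy yV.
  have ky := twinR _ _ _ xk xy; have yx : R y x by rewrite Rsym.
  have twin_y c : R c k -> twin y c.
    by move=> ck; apply: (twin_of _ _ x) => //; apply: (Rpath _ k y).
  apply/orP; right; apply/hasP.
  have [kab|[[c cab ck]|kk]] := L0P k kL.
  - exists (m k).
      by move: kab; rewrite !inE => /orP[]/eqP->; rewrite eqxx ?orbT.
    by apply: twin_y; rewrite Rsym; case: (Rm k y ky yV).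
  - exists c; last exact: twin_y.
    by move: cab; rewrite !inE => /orP[]/eqP->; rewrite eqxx ?orbT.
  - by exists k => //; apply: twin_y.
have untouched_color x y : ~~ touched x -> R x y -> x \in V -> y \in V ->
    color y = ~~ color x.
  move=> tx xy xV yV; have [xm mV] := Rm x y xy yV.
  have yx : R y x by rewrite Rsym.
  have [ym mV'] := Rm y x yx xV.
  have [mm mmV] : R (m x) (m (m x)) /\ m (m x) \in V.
    by apply: (Rm _ x); rewrite // Rsym.
  have eqm u w : twin u w -> N u != [::] -> m u = m w.
    by move=> /twinN e1; rewrite /m -e1; case: (N u).
  have nN u w : R u w -> w \in V -> N u != [::].
    by move=> uw wV; have := mN u w uw wV; case: (N u).
  have e1 : m y = m (m x).
    by apply: eqm (nN _ _ yx xV); apply: (twin_of _ _ x) => //; rewrite Rsym.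
  have e2 : m (m y) = m x.
    rewrite e1; apply/esym; apply: eqm (nN _ _ xy yV).
    by apply: (twin_of _ _ (m x)) => //; rewrite Rsym.
  rewrite /color e2 e1 -leqNgt [in RHS]leq_eqVlt orbC.
  case: eqP => [E|_]; last by rewrite orbF.
  have q : R (m x) (m x) by rewrite -{1}E Rsym.
  have [ll lV] := loopP _ mV q.
  case/negP: tx; apply/orP; right; apply/hasP; exists l.
    by rewrite !inE eqxx !orbT.
  by apply: (twin_of _ _ (m x)) => //; apply: Rloop.
have untouched_f x y : ~~ touched x -> R x y -> y \in V ->
    f x = if color x then e else m e.
  move=> tx xy yV; rewrite /f.
  have := tx; rewrite negb_or !inE negb_or -andbA => /and3P[/negPf-> /negPf-> /negPf->].
  by have := mN x y xy yV; case: (N x).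
have eP x y : R x y -> x \in V -> y \in V -> R e (m e).
  move=> xy xV yV; have : e \in [seq y <- V | N y != [::]].
    apply: (@head_in _ _ x); rewrite mem_filter xV andbT.
    by have := mN x y xy yV; case: (N x).
  rewrite mem_filter => /andP[Ne eV]; rewrite /m; case E : (N e) Ne => [|q s] // _.
  by have : q \in N e; [rewrite E mem_head|rewrite mem_filter => /andP[]].
exists f, [:: a; b; m a; m b; l; o; e; m e]; split=> //.
- move=> x; rewrite /f; case: eqP => _; first by rewrite !inE eqxx.
  case: eqP => _; first by rewrite !inE eqxx ?orbT.
  case: ifP => [/hasP[k kL xk]|_].
    have : head o [seq y <- L0 | twin x y] \in [seq y <- L0 | twin x y].
      by apply: (@head_in _ _ k); rewrite mem_filter xk.
    rewrite mem_filter => /andP[_].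
    by rewrite !inE => /or4P[->|->|->|/orP[->|->]]; rewrite ?orbT.
  by case: ifP => _; [|case: ifP => _]; rewrite !inE eqxx ?orbT.
- by rewrite /f eqxx.
- by rewrite /f eqxx; case: eqP.
split=> [x y xV yV xy|x xV].
  have yx : R y x by rewrite Rsym.
  case tx : (touched x).
    have ty := touched_nbr x y tx xy xV yV; rewrite Rsym.
    apply: (touched_f y x) => //; rewrite Rsym; exact: (touched_f x y).
  move/negbT: tx => tx; have ty : ~~ touched y.
    by apply: contra tx => ty; apply: (touched_nbr y x).
  rewrite (untouched_f x y) // (untouched_f y x) //.
  rewrite (untouched_color x y) //; have := eP x y xy xV yV.
  by case: (color x); rewrite //= Rsym.
case Nx : (N x) => [|q s].
  left; rewrite /f; case: eqP => [<- //|_]; case: eqP => [<- //|_].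
  case: ifP => [/hasP[k _ /hasP[u uV /andP[xu _]]]|_].
    by have := mN x u xu uV; rewrite Nx.
  by rewrite Nx eqxx; apply: (@head_in _ _ x).
have : q \in N x by rewrite Nx mem_head.
rewrite mem_filter => /andP[xq qV]; right.
case tx : (touched x).
  by exists q; apply: (touched_f x q).
rewrite (untouched_f x q) ?tx //; have ee := eP x q xq xV qV.
by case: (color x); [exists (m e)|exists e; rewrite Rsym].
Qed.

(** * The variety K: words of length at least three *)

(** In K a word of length at least three is the sum of the cubes of its
    letters ([long_le]), so every word splits into words of length at most two
    and cubes. *)
Definition split_word (p : seq nat) : seq (seq nat) :=
  if size p <= 2 then [:: p] else [seq [:: i; i; i] | i <- p].

Definition short_words (t : term) : seq (seq nat) :=
  flatten [seq split_word p | p <- words t].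

Definition letters (t : term) : seq nat := flatten (words t).

Lemma short_wordsP t p : p \in short_words t ->
  {subset p <= letters t} /\
  exists i j, [\/ p = [:: i], p = [:: i; j] | p = [:: i; i; i]].
Proof.
move=> /flatten_mapP[q qt]; rewrite /split_word.
have ql : {subset q <= letters t} by move=> i iq; apply/flattenP; exists q.
case: ifP => [|_ /mapP[i iq ->]].
  rewrite inE => q2 /eqP->; split=> //; have := words_neq_nil qt.
  by case: q q2 {qt ql} => [|i [|j [|]]] // _ _;
    [exists i, i; constructor 1|exists i, j; constructor 2].
split; last by exists i, i; constructor 3.
by move=> j; rewrite !inE => /or3P[]/eqP->; apply: ql.
Qed.

Section VarietyK.
Variable S : algebra.
Hypothesis KS : variety_K S.

Local Notation "x ⊕ y" := (@alg_add S x y) (at level 50, left associativity).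
Local Notation "x ⊗ y" := (@alg_mul S x y) (at level 40, left associativity).
Local Notation "x ≼ y" := (@le S x y) (at level 70, no associativity).

Implicit Types (a b c d x y z : S) (v : nat -> S).

Let AS : variety_A S. Proof. by case: KS. Qed.
Let CS : commutative_ai_semiring S. Proof. exact: A_com AS. Qed.

Lemma path_le a b c d z :
  a ⊗ b ≼ z -> b ⊗ c ≼ z -> c ⊗ d ≼ z -> a ⊗ d ≼ z.
Proof.
move=> ab bc cd; case: KS => _ h; have /= e := h (nth a [:: a; a; b; c; d]).
have : a ⊗ b ⊕ b ⊗ c ⊕ c ⊗ d ≼ z by do ![apply/(add_le CS); split=> //].
by rewrite e => /(add_le CS)[].
Qed.

(** This is [path_le] for the path a b, c, a, d: its first two products are below
    a b c. *)
Lemma insert_le a b c d z : a ⊗ b ⊗ c ≼ z -> a ⊗ d ≼ z -> a ⊗ b ⊗ d ≼ z.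
Proof.
move=> abc; apply: (path_le abc).
apply: (le_trans CS) abc; rewrite (mulsC CS); apply: (le_mul2 CS).
  exact: (le_mull AS).
exact: (le_refl CS).
Qed.

Lemma double_le a b c z : a ⊗ b ⊗ c ≼ z -> a ⊗ b ⊗ (b ⊗ c) ≼ z.
Proof. by move=> abc; apply: (insert_le abc); rewrite (mulsA CS). Qed.

Definition cube x := x ⊗ x ⊗ x.

Lemma cube_mono x y : x ≼ y -> cube x ≼ cube y.
Proof. by move=> xy; do !apply: (le_mul2 CS). Qed.

Lemma sqr_le_cube x : x ⊗ x ≼ cube x. Proof. exact: (le_mull AS). Qed.

(** Doubling the middle factor twice produces its cube. *)
Lemma cube_le_mid a b c z : a ⊗ b ⊗ c ≼ z -> cube b ≼ z.
Proof.
move=> /double_le/double_le; apply: (le_trans CS); rewrite /cube -(mulsA CS).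
apply: (le_mul2 CS); first exact: (le_mulr AS).
apply: (le_mul2 CS); first exact: (le_refl CS).
exact: (le_mull AS).
Qed.

Lemma cube_pair_le x y z : cube x ≼ z -> cube y ≼ z -> x ⊗ y ≼ z.
Proof.
by move=> xz yz; apply: (mul_le_sqr AS);
  [apply: (le_trans CS) xz|apply: (le_trans CS) yz]; apply: sqr_le_cube.
Qed.

(** Cubes spread to all squares below the same bound, so an endomorphism that
    preserves squares preserves cubes. *)
Lemma cube_spread x y z : cube x ≼ z -> y ⊗ y ≼ z -> cube y ≼ z.
Proof.
move=> xz yy; have xy : x ⊗ y ≼ z.
  by apply: (mul_le_sqr AS) => //; apply: (le_trans CS) xz; apply: sqr_le_cube.
have xxy := insert_le xz xy.
have yxx : y ⊗ x ⊗ x ≼ z by rewrite -(mulsA CS) (mulsC CS).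
have := insert_le yxx yy; rewrite -(mulsA CS) (mulsC CS x) (mulsA CS).
by move=> /insert_le; apply.
Qed.

(** Up to commutation each letter of a long word is a middle factor, whence its
    cube is below the word.  Conversely [double_le] and [insert_le] attach one
    more letter to a word as long as the word is accompanied by a square. *)
Lemma long_le v p z : 2 < size p ->
  evalw v p ≼ z <-> forall i, i \in p -> cube (v i) ≼ z.
Proof.
move=> p2; split=> [pz i|].
- case: p p2 pz => [|j [|k r]] // r0 pz.
  have rn : r <> [::] by move=> e; rewrite e in r0.
  have {}pz : v j ⊗ (v k ⊗ evalw v r) ≼ z by case: r pz {r0} rn.
  rewrite !inE => /or3P[/eqP->|/eqP->|ir].
  + by apply: (@cube_le_mid (v k) _ (evalw v r)); rewrite -(mulsA CS) (mulsCA CS).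
  + by apply: (@cube_le_mid (v j) _ (evalw v r)); rewrite -(mulsA CS).
  + apply: (le_trans CS) (_ : cube (evalw v r) ≼ z).
      by apply: cube_mono; apply: letter_le.
    by apply: (@cube_le_mid (v j) _ (v k)); rewrite -(mulsA CS) (mulsC CS (evalw _ _)).
- move=> pz; suff h x : p <> [::] -> cube x ≼ z -> evalw v p ⊗ (x ⊗ x) ≼ z.
    have [i ip] : exists i, i \in p.
      by case: p p2 {pz h} => // i q; exists i; apply: mem_head.
    apply: (le_trans CS) (h _ _ (pz i ip)); first exact: (le_mull AS).
    by move=> p0; rewrite p0 in p2.
  elim: p {p2} pz x => // i p IH pz x _ xz.
  have [iz {}pz] : cube (v i) ≼ z /\ forall j, j \in p -> cube (v j) ≼ z.
    by split=> [|j jp]; apply: pz; rewrite inE ?eqxx // jp orbT.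
  have xi : x ⊗ v i ≼ z by apply: cube_pair_le.
  case: p IH pz => [|j p] IH pz.
    by rewrite (mulsC CS); apply: insert_le xz xi.
  rewrite evalw_cons //; set q := evalw v (j :: p).
  have qxx : q ⊗ (x ⊗ x) ≼ z by apply: IH.
  have : x ⊗ (q ⊗ x) ⊗ v i ≼ z.
    apply: insert_le xi; have := @double_le q x x z.
    by rewrite -!(mulsA CS) (mulsCA CS x q); apply.
  by rewrite (mulsCA CS) (mulsC CS _ (v i)) (mulsA CS).
Qed.

Lemma eval_short_le v t z :
  eval v t ≼ z <-> forall p, p \in short_words t -> evalw v p ≼ z.
Proof.
rewrite (eval_le CS); split=> [h p /flatten_mapP[q qt]|h p pt].
  rewrite /split_word; case: leqP => [_|q2]; first by rewrite inE => /eqP->; apply: h.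
  move=> /mapP[i iq ->] /=; rewrite (mulsA CS).
  by apply: (long_le v z q2).1 iq; apply: h.
have sh q : q \in split_word p -> evalw v q ≼ z.
  by move=> qp; apply: h; apply/flatten_mapP; exists p.
move: sh; rewrite /split_word; case: leqP => [_|p2] sh; first by apply: sh; rewrite inE.
apply/long_le => // i ip; rewrite /cube -(mulsA CS); apply: (sh [:: i; i; i]).
by apply/mapP; exists i.
Qed.

(** At a fixed valuation and a fixed bound [z], the relation that the product
    of two variables is below [z] satisfies the hypotheses of [fold_graph];
    an endomorphism of this graph keeps the value of the term below [z]. *)
Lemma fold_term v s (i j : nat) : exists (f : nat -> nat) (L : seq nat),
  [/\ size L <= 10, forall k, f k \in L, f i = i, f j = j &
   eval (v \o f) s ≼ eval v s].
Proof.
set z := eval v s.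
pose R : rel nat := fun k l => `[< v k ⊗ v l ≼ z >].
have Rsym : symmetric R by move=> k l; rewrite /R (mulsC CS).
have Rpath (a b c d : nat) : R a b -> R b c -> R c d -> R a d.
  by move=> /asboolP ab /asboolP bc /asboolP cd; apply/asboolP; apply: path_le ab bc cd.
have Rloop (a b : nat) : R a a -> R b b -> R a b.
  by move=> /asboolP aa /asboolP bb; apply/asboolP; apply: (mul_le_sqr AS).
have [f [L [L10 fL fi fj [fR fV]]]] := fold_graph (letters s) i j Rsym Rpath Rloop.
exists f, L; split=> //; apply/eval_short_le => p ps.
have [pl [k [l pE]]] := short_wordsP ps.
have pz : evalw v p ≼ z by move: {pE pl} p ps; apply/eval_short_le; apply: (le_refl CS).
case: pE => E; subst p; rewrite /= in pz pl *.
- have [fs|[u /asboolP]] := fV k (pl k (mem_head _ _)).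
    have /flattenP[q qs kq] := fs; apply: (le_trans CS) (letter_le AS v kq) _.
    exact: evalw_le_eval.
  by apply: (le_trans CS); apply: (le_mull AS).
- apply/asboolP; apply: fR; [exact: pl (mem_head _ _)| |exact/asboolP].
  by apply: pl; rewrite !inE eqxx orbT.
- have ks := pl k (mem_head _ _).
  have kk : R k k.
    by apply/asboolP; apply: (le_trans CS) pz; rewrite (mulsA CS); apply: (le_mull AS).
  have /asboolP fkk := fR k k ks ks kk.
  by rewrite (mulsA CS); apply: cube_spread fkk; rewrite /cube -(mulsA CS); apply: pz.
Qed.

End VarietyK.

(** * Subvarieties of K *)

Definition A_axiom (i : 'I_9) : identity :=
  nth ('x_0 ≈ 'x_0)
    [:: ('x_0 + ('x_1 + 'x_2) ≈ ('x_0 + 'x_1) + 'x_2);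
        ('x_0 + 'x_1 ≈ 'x_1 + 'x_0);
        ('x_0 + 'x_0 ≈ 'x_0);
        ('x_0 * ('x_1 * 'x_2) ≈ ('x_0 * 'x_1) * 'x_2);
        ('x_0 * 'x_1 ≈ 'x_1 * 'x_0);
        (('x_0 + 'x_1) * 'x_2 ≈ 'x_0 * 'x_2 + 'x_1 * 'x_2);
        ('x_0 * ('x_1 + 'x_2) ≈ 'x_0 * 'x_1 + 'x_0 * 'x_2);
        ('x_0 * 'x_1 + 'x_0 ≈ 'x_0 * 'x_1);
        ('x_0 * 'x_0 + 'x_1 * 'x_1 + 'x_0 * 'x_1 ≈ 'x_0 * 'x_0 + 'x_1 * 'x_1)] i.

Definition K_axiom (i : option 'I_9) : identity :=
  if i is Some i then A_axiom i else K_identity.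

Lemma A_axiomP (S : algebra) : (forall i, satisfies S (A_axiom i)) <-> variety_A S.
Proof.
split=> [h|[[[[aA aC aI] mA dl dr] mC] h1 h2] [[|[|[|[|[|[|[|[|[|//]]]]]]]]] i_lt]] /=;
  last 9 first.
- by move=> v /=; rewrite aA.
- by move=> v /=; rewrite aC.
- by move=> v /=; apply: aI.
- by move=> v /=; rewrite mA.
- by move=> v /=; rewrite mC.
- by move=> v /=; apply: dl.
- by move=> v /=; apply: dr.
- exact: h1.
- exact: h2.
have ax i (i9 : i < 9) : satisfies S (A_axiom (Ordinal i9)) by apply: h.
split; [split; [split; [split| | |]|]| |].
- by move=> x y z; have := ax 0 erefl (nth x [:: x; y; z]).
- by move=> x y; have := ax 1 erefl (nth x [:: x; y]).
- by move=> x; have := ax 2 erefl (fun=> x).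
- by move=> x y z; have := ax 3 erefl (nth x [:: x; y; z]).
- by move=> x y z; have := ax 5 erefl (nth x [:: x; y; z]).
- by move=> x y z; have := ax 6 erefl (nth x [:: x; y; z]).
- by move=> x y; have := ax 4 erefl (nth x [:: x; y]).
- exact: (ax 7).
- exact: (ax 8).
Qed.

Lemma K_axiomP (S : algebra) : (forall i, satisfies S (K_axiom i)) <-> variety_K S.
Proof.
split=> [h|[/A_axiomP hA hK] [i|]]; [split|exact: hA|exact: hK].
- by apply/A_axiomP => i; apply: (h (Some i)).
- exact: (h None).
Qed.

Lemma generated_A (S : algebra) : variety_A S -> generated_variety S `<=` variety_A.
Proof.
by move=> /A_axiomP AS T VT; apply/A_axiomP => i; apply: generated_satisfies VT.
Qed.

Fixpoint rename (f : nat -> nat) (t : term) : term :=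
  match t with
  | Var i => Var (f i)
  | Add s t => Add (rename f s) (rename f t)
  | Mul s t => Mul (rename f s) (rename f t)
  end.

Lemma eval_rename (S : algebra) (v : nat -> S) f t :
  eval v (rename f t) = eval (v \o f) t.
Proof. by elim: t => //= s -> t ->. Qed.

Lemma letters_rename f t k : k \in letters (rename f t) -> exists i, k = f i.
Proof.
move=> /flattenP[p]; elim: t p => [i|s IHs t IHt|s IHs t IHt] p /=.
- by rewrite inE => /eqP->; rewrite inE => /eqP->; exists i.
- by rewrite mem_cat => /orP[/IHs|/IHt]; apply.
- move=> /allpairsP[[q r] /= [qs rt ->]]; rewrite mem_cat => /orP[].
    exact: IHs qs.
  exact: IHt rt.
Qed.

Lemma satisfies_rename (S : algebra) f s t :
  satisfies S (s, t) -> satisfies S (rename f s, rename f t).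
Proof. by move=> h v; rewrite /= !eval_rename; apply: (h (v \o f)). Qed.

Fixpoint sum_words (l : seq (seq nat)) : term :=
  match l with
  | [::] => Var 0
  | [:: p] => wterm p
  | p :: q => Add (wterm p) (sum_words q)
  end.

Lemma sum_words_le (S : algebra) (v : nat -> S) l z :
  commutative_ai_semiring S -> l <> [::] ->
  le (eval v (sum_words l)) z <-> forall p, p \in l -> le (evalw v p) z.
Proof.
move=> CS; elim: l => // p [_ _|q l IH _] /=.
  rewrite eval_wterm; split=> [h q|]; last by apply; rewrite inE.
  by rewrite inE => /eqP->.
rewrite (add_le CS) eval_wterm; split=> [[hp] /IH h r|h].
  by rewrite inE => /predU1P[->|]; [|apply: h].
split; first by apply: h; rewrite inE eqxx.
by apply/IH => // r rl; apply: h; rewrite inE rl orbT.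
Qed.

Definition words10 : seq (seq nat) :=
  [seq [:: i] | i <- iota 0 10] ++ [seq [:: i; j] | i <- iota 0 10, j <- iota 0 10]
  ++ [seq [:: i; i; i] | i <- iota 0 10].

(** A set of words from [words10], as a bit mask. *)
Definition selection := (size words10).-tuple bool.

(** Every term in ten variables is equal in K to the sum of a selection of
    [words10], so K has finitely many such terms up to equality. *)
Definition normal_term (m : selection) : term := sum_words (mask m words10).

Definition support (t : term) : selection :=
  [tuple of [seq p \in short_words t | p <- in_tuple words10]].

Lemma mem_words10 t p : (forall k, k \in letters t -> k < 10) ->
  p \in short_words t -> p \in words10.
Proof.
move=> t10 /short_wordsP[pl [i [j pE]]].
have p10 k : k \in p -> k \in iota 0 10.
  by move=> kp; rewrite mem_iota add0n /=; apply: t10; apply: pl.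
rewrite /words10 2!mem_cat; case: pE => E; subst p.
- by rewrite map_f // p10 // mem_head.
- apply/orP; right; apply/orP; left.
  by apply: (allpairs_f (fun i j => [:: i; j])); apply: p10; rewrite !inE eqxx ?orbT.
- by rewrite (map_f (fun i => [:: i; i; i])) ?orbT // p10 // mem_head.
Qed.

Lemma normal_termE (S : algebra) (v : nat -> S) t : variety_K S ->
  (forall k, k \in letters t -> k < 10) ->
  eval v (normal_term (support t)) = eval v t.
Proof.
move=> KS t10; have CS := A_com KS.1.
have [p pt] : exists p, p \in short_words t.
  have [q qt] := words_neq0 t; have qn := words_neq_nil qt.
  suff [p pq] : exists p, p \in split_word q.
    by exists p; apply/flatten_mapP; exists q.
  rewrite /split_word; case: ifP => _; first by exists q; rewrite inE.
  by case: q qn {qt} => // i q _; exists [:: i; i; i]; apply: mem_head.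
have memE q : q \in mask (support t) words10 = (q \in short_words t).
  have -> : mask (support t) words10 = [seq p <- words10 | p \in short_words t].
    by rewrite filter_mask.
  rewrite mem_filter; apply: andb_idr; exact: mem_words10 t10.
apply: (eq_le CS) => z; rewrite (sum_words_le _ _ CS).
  by rewrite (eval_short_le KS); split=> h q hq; apply: h; rewrite ?memE // -memE.
by move=> e; move: (memE p); rewrite e pt.
Qed.

Definition candidate (c : option 'I_9 + selection * selection) : identity :=
  match c with
  | inl i => K_axiom i
  | inr (m, n) => (normal_term m, normal_term n)
  end.

Lemma candidate_vars c :
  term_vars (candidate c).1 `|` term_vars (candidate c).2 `<=` `I_10.
Proof.
have wv p : (forall k, k \in p -> k < 10) -> term_vars (wterm p) `<=` `I_10.
  elim: p => [|i [|j q] IH] p10; first by move=> k /= ->.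
    by move=> k /= ->; apply: p10; apply: mem_head.
  move=> k [->|]; first by apply: p10; apply: mem_head.
  by apply: IH => l lq; apply: p10; rewrite inE lq orbT.
have sv l : {subset l <= words10} -> term_vars (sum_words l) `<=` `I_10.
  have w10 p : p \in words10 -> forall k, k \in p -> k < 10.
    have /allP h : all (all (fun k => k < 10)) words10 by [].
    by move=> /h /allP.
  elim: l => [|p [|q l] IH] l10; first by move=> k /= ->.
    by apply/wv/w10/l10; apply: mem_head.
  move=> k []; first by apply/wv/w10/l10; apply: mem_head.
  by apply: IH => r rl; apply: l10; rewrite inE rl orbT.
case: c => [i|[m n]]; last by move=> k []; apply: sv => p /mem_mask.
case: i => [[[|[|[|[|[|[|[|[|[|//]]]]]]]]] i_lt]|] /=;
  by move=> k; repeat first [by move=> -> | case].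
Qed.

(** By [fold_term], an inequality of [W] whose left side is a word of length at
    most two or a cube follows at a given valuation from one of its instances
    in ten variables, and in K this instance is equivalent to a candidate. *)
Lemma subvariety_K_basis (W : set algebra) : subvariety W variety_K ->
  W = models (candidate @` [set c | class_satisfies W (candidate c)]).
Proof.
move=> [vW WK]; apply/seteqP; split=> [S WS _ [c cW <-]|S SE]; first exact: cW.
have cS c : class_satisfies W (candidate c) -> satisfies S (candidate c).
  by move=> cW; apply: SE; exists c.
have KS : variety_K S.
  by apply/K_axiomP => i; apply: (cS (inl i)) => T /WK /K_axiomP; apply.
have CS := A_com KS.1; apply: birkhoff => // -[s t] st v /=.
have WC T : W T -> commutative_ai_semiring T by move=> /WK[/A_com].
have normS s' t' : (forall k, k \in letters s' -> k < 10) ->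
    (forall k, k \in letters t' -> k < 10) ->
    class_satisfies W (s', t') -> satisfies S (s', t').
  move=> s10 t10 h; have /= e := cS (inr (support s', support t')).
  move=> u; rewrite /= -(normal_termE u KS s10) -(normal_termE u KS t10).
  by apply: e => T WT w; rewrite /= !normal_termE ?(h T WT) //; apply: WK.
have main s' t' : class_satisfies W (s', t') -> le (eval v t') (eval v s').
  move=> {s t} st; apply/(eval_short_le KS) => p pt.
  have [_ [i [j pE]]] := short_wordsP pt.
  have [f [L [L10 fL fi fj fv]]] := fold_term KS v s' i j.
  pose r k := index (f k) L.
  have r10 q k : k \in letters (rename r q) -> k < 10.
    by move=> /letters_rename[l ->]; apply: leq_trans L10; rewrite index_mem.
  have h : class_satisfies W (Add s' (wterm p), s').
    move=> T WT; have KT := WK T WT; have CT := A_com KT.1.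
    apply/(satisfies_add_wterm CT) => u; rewrite (st T WT u).
    by move: p pt {pE}; apply/(eval_short_le KT); apply: (le_refl CT).
  have /(_ (v \o nth 0 L)) := normS _ _ (r10 _) (r10 _)
     (fun T WT => satisfies_rename r (h T WT)).
  rewrite /= !eval_rename eval_wterm.
  have -> : (v \o nth 0 L) \o r = v \o f.
    by apply/funext => k /=; rewrite /r nth_index.
  have -> : evalw (v \o f) p = evalw v p.
    by case: pE => -> /=; rewrite ?fi ?fj.
  by rewrite (addsC CS) => h'; apply: (le_trans CS) fv.
by apply: (le_anti CS); apply: main => // T WT w; rewrite /= (st T WT w).
Qed.

Lemma subvariety_K_finite_basis (W : set algebra) : subvariety W variety_K ->
  exists E : set identity, finite_basis W E /\ (vars E #<= `I_10)%card.
Proof.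
move=> WK; exists (candidate @` [set c | class_satisfies W (candidate c)]).
split; first by split; [exact/finite_image/finite_finset|exact: subvariety_K_basis].
by apply: subset_card_le => k [_ [c _ <-]]; apply: candidate_vars.
Qed.

Lemma finite_subvarieties_K : finite_set [set W | subvariety W variety_K].
Proof.
pose g (C : {set (option 'I_9 + selection * selection)}) :=
  models (candidate @` [set` C]).
apply: (@sub_finite_set _ _ (range g)); last exact/finite_image/finite_finset.
move=> W /subvariety_K_basis WE.
exists [set c | `[< class_satisfies W (candidate c) >] ]%SET => //.
rewrite /g [RHS]WE; congr (models (_ @` _)).
by apply/seteqP; split=> c /=; rewrite inE => /asboolP.
Qed.

(** * Identities that fail in TR6 *)

Lemma TR6_com : commutative_ai_semiring TR6.
Proof.
by split; [split; [split| | |]|]; do ?[by case=> [] [] []|by case=> [] []|by case].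
Qed.

Lemma TR6_A : variety_A TR6.
Proof.
split; first exact: TR6_com.
- by move=> v /=; case: (v 0) (v 1) => [] [].
- by move=> v /=; case: (v 0) (v 1) => [] [].
Qed.

Lemma TR6_not_K : ~ satisfies TR6 K_identity.
Proof. by move=> /(_ (nth e1 [:: e1; e4; e5; e6; e2])). Qed.

Lemma TR6_mul3 (a b c : TR6) : alg_mul a (alg_mul b c) = e1.
Proof. by case: a b c => [] [] []. Qed.

Lemma TR6_long (v : nat -> TR6) p : 2 < size p -> evalw v p = e1.
Proof.
case: p => [|i [|j [|k r]]] // _.
by rewrite evalw_cons // evalw_cons // TR6_mul3.
Qed.

Lemma TR6_le_e3 (x : TR6) : le x (e3 : TR6) <-> x <> e1.
Proof. by case: x; split. Qed.

Lemma TR6_e1_or_le (x : TR6) : x = e1 \/ le x (e3 : TR6).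
Proof. by case: x; [left|right..]. Qed.

(** The elements 4, 5, 6, 2 form the path of products equal to 3, and a path
    of elements of a member of the variety A can be substituted for it. *)
Definition subst6 (S : algebra) (a b c d z q : S) (x : TR6) : S :=
  match x with
  | e1 => q | e2 => d | e3 => z | e4 => a | e5 => b | e6 => c
  end.

Section Substitution.
Variable S : algebra.
Hypothesis AS : variety_A S.

Local Notation "x ⊕ y" := (@alg_add S x y) (at level 50, left associativity).
Local Notation "x ⊗ y" := (@alg_mul S x y) (at level 40, left associativity).
Local Notation "x ≼ y" := (@le S x y) (at level 70, no associativity).

Let CS : commutative_ai_semiring S. Proof. exact: A_com AS. Qed.

Definition is_path (a b c d z : S) : Prop :=
  [/\ a ⊗ b ≼ z, b ⊗ c ≼ z & c ⊗ d ≼ z].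

Lemma subst6_le (a b c d z q : S) (w : nat -> TR6) p : is_path a b c d z ->
  p <> [::] -> evalw w p <> e1 -> evalw (subst6 a b c d z q \o w) p ≼ z.
Proof.
move=> [ab bc cd] pn wp.
have p2 : size p <= 2 by case: leqP => // /(TR6_long w).
have M := le_trans CS; have ml := le_mull AS; have mr := le_mulr AS.
have cb := bc; have ba := ab; have dc := cd.
rewrite (mulsC CS) in cb; rewrite (mulsC CS) in ba; rewrite (mulsC CS) in dc.
case: p pn wp p2 => [//|i [|j [|//]]] _ /= wp _.
  by case: (w i) wp => //= _;
    [exact: M cd|exact: (le_refl CS)|exact: M ab|exact: M bc|exact: M cd].
by case: (w i) wp => /=; case: (w j) => //=.
Qed.

(** Walks that go back and forth along an edge are paths too; unless the
    hypothesis bounds the product of the ends directly, it bounds their squares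
    when it is applied to such walks. *)
Lemma path_ends_le (i j : TR6) : alg_mul i j = e1 ->
  (forall a b c d z : S, is_path a b c d z ->
     subst6 a b c d z (a ⊗ d) i ⊗ subst6 a b c d z (a ⊗ d) j ≼ z) ->
  forall a b c d z : S, is_path a b c d z -> a ⊗ d ≼ z.
Proof.
move=> ij P a b c d z abcd; have [ab bc cd] := abcd.
have M := le_trans CS; have ml := le_mull AS; have mr := le_mulr AS.
have rf := le_refl CS.
have cb := bc; have ba := ab; have dc := cd.
rewrite (mulsC CS) in cb; rewrite (mulsC CS) in ba; rewrite (mulsC CS) in dc.
have az : a ≼ z by apply: M ab.
have dz : d ≼ z by apply: M cd.
have sqr : a ⊗ a ≼ z -> d ⊗ d ≼ z -> a ⊗ d ≼ z by apply: mul_le_sqr.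
have zl x y : x ≼ z -> z ⊗ y ≼ z -> x ⊗ y ≼ z.
  by move=> xz; apply: M; apply: (le_mul2 CS).
have zr x y : x ≼ z -> y ⊗ z ≼ z -> x ⊗ y ≼ z.
  by rewrite (mulsC CS y); apply: zl.
have zl' x : x ≼ z -> z ⊗ z ≼ z -> z ⊗ x ≼ z by move=> xz; rewrite (mulsC CS); apply: zl.
have p0 := P a b c d z abcd.
have p1 := P d c b a z (And3 dc cb ba).
have p2 := P b a b a z (And3 ba ab ba).
have p3 := P a b a b z (And3 ab ba ab).
have p4 := P c d c d z (And3 cd dc cd).
have p5 := P d c d c z (And3 dc cd dc).
case: i j ij {P} p0 p1 p2 p3 p4 p5 => [] [] //= _ p0 p1 p2 p3 p4 p5;
  first [ exact: p0 | by rewrite (mulsC CS) | by apply: sqr | by apply: zl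
        | by apply: zr | by apply/zl/zl'
        | exact: (M _ _ _ (ml _ _) p0) | exact: (M _ _ _ (mr _ _) p0) ].
Qed.

End Substitution.

(** As the path 4, 5, 6, 2 has no triangle, among any three letters of a word
    two have values with product 1. *)
Lemma TR6_word_e1 (w : nat -> TR6) p : p <> [::] -> evalw w p = e1 ->
  (exists2 k, k \in p & w k = e1) \/
  (exists k l, alg_mul (w k) (w l) = e1 /\
     forall S : algebra, variety_A S -> forall v : nat -> S,
       le (alg_mul (v k) (v l)) (evalw v p)).
Proof.
case: p => // k [|l [|m r]] _.
- by left; exists k => //; apply: mem_head.
- move=> kl; right; exists k, l; split=> // S AS v.
  exact: (le_refl (A_com AS)).
move=> _; right; have [kl|kl] : alg_mul (w k) (w l) = e1 \/ alg_mul (w k) (w l) <> e1.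
    by case: (w k) (w l) => [] []; (by left) || (by right).
  exists k, l; split=> // S AS v; apply: (pair_le AS); exact: mem_head.
have [km|km] : alg_mul (w k) (w m) = e1 \/ alg_mul (w k) (w m) <> e1.
    by case: (w k) (w m) => [] []; (by left) || (by right).
  exists k, m; split=> // S AS v; apply: (pair_le AS).
  by rewrite !inE eqxx orbT.
exists l, m; split=> [|S AS v].
  by case: (w k) (w l) (w m) kl km => [] [] // [].
rewrite evalw_cons //; apply: (le_trans (A_com AS)) (le_mulr AS _ _).
by apply: (pair_le AS); apply: mem_head.
Qed.

(** In the main case [s] has value 3 and [p] has value 1, so that [subst6] turns
    the inequality into the hypothesis of [path_ends_le]. *)
Lemma K_of_failing_le (V : set algebra) s p (w : nat -> TR6) :
  V `<=` variety_A -> p <> [::] -> entails_le V p s ->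
  ~ le (evalw w p) (eval w s) -> class_satisfies V K_identity.
Proof.
move=> VA pn ps wps S VS v; have AS := VA S VS; have CS := A_com AS.
have M := le_trans CS; have ml := le_mull AS; have mr := le_mulr AS.
suff ends (a b c d z : S) : is_path a b c d z -> le (alg_mul a d) z.
  set lhs := eval v _.1; have h : is_path (v 1) (v 2) (v 3) (v 4) lhs.
    have : le lhs lhs by apply: (le_refl CS).
    by rewrite {1}/lhs /= => /(add_le CS)[/(add_le CS)[? ?] ?]; split.
  by have := ends _ _ _ _ _ h; rewrite /le (addsC CS) => {1}<-.
case: (pselect (eval w s = e3 \/ eval w s = e1)) => [[] sE|sE].
- have pE : evalw w p = e1.
    by move: wps; rewrite sE; case: (evalw w p) => // h; case: h.
  have below (a0 b0 c0 d0 z0 q0 : S) : is_path a0 b0 c0 d0 z0 ->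
      le (evalw (subst6 a0 b0 c0 d0 z0 q0 \o w) p) z0.
    move=> h; apply: (M _ _ _ (ps S VS _)); apply/(eval_le CS) => r rs.
    apply: (subst6_le AS _ h); first exact: words_neq_nil rs.
    by apply/TR6_le_e3; rewrite -sE; apply: (evalw_le_eval TR6_com).
  have [[k kp k1]|[k [l [kl1 klp]]]] := TR6_word_e1 pn pE.
    move=> abcd; apply: M (below a b c d z (alg_mul a d) abcd).
    by have := letter_le AS (subst6 a b c d z (alg_mul a d) \o w) kp; rewrite /= k1.
  apply: (path_ends_le AS kl1) => a0 b0 c0 d0 z0 h.
  exact: (M _ _ _ (klp S AS _) (below _ _ _ _ _ _ h)).
- by case: wps; rewrite sE; case: (evalw w p).
(* The value of [s] is neither 3 nor 1, hence above no product: every word of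
   [s] is a single letter. *)
move=> [ab bc cd].
have s1 r : r \in words s -> exists k, r = [:: k].
  move=> rs; have rn := words_neq_nil rs; have := evalw_le_eval TR6_com w rs.
  case: r rs rn => // k [|l r] rs _; first by exists k.
  rewrite evalw_cons //; move: sE; case: (eval w s) => [] h; do ?[by case: h; auto];
    by case: (w k) (evalw w (l :: r)) => [] [].
case: p pn ps wps => // k [|l r] _ ps wps.
  pose u m := if m == k then alg_mul a d else z.
  have := ps S VS u; rewrite /= {1}/u eqxx => h; apply: (M _ _ _ h).
  apply/(eval_le CS) => q qs; have [m qE] := s1 q qs; subst q.
  rewrite /= /u; case: eqP => [mk|_]; last exact: (le_refl CS).
  by case: wps; apply: (evalw_le_eval TR6_com); rewrite -mk.
have := ps S VS (fun=> alg_add a d); rewrite evalw_cons // => h.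
apply: (M (eval (fun=> alg_add a d) s)); first apply: (M _ _ _ _ h).
- apply: (le_mul2 CS); first exact: (le_addl CS).
  apply: (M _ _ _ (le_addr CS a d)).
  exact: (letter_le AS (fun=> alg_add a d) (mem_head l r)).
- apply/(eval_le CS) => q qs; have [m ->] := s1 q qs => /=.
  by apply/(add_le CS); split; [apply: M ab|apply: M cd].
Qed.

Lemma K_of_not_TR6 (V : set algebra) : subvariety V variety_A -> ~ V TR6 ->
  class_satisfies V K_identity.
Proof.
move=> [vV VA] nV; apply: contrapT => nK; apply: nV; apply: birkhoff => // -[s t] st.
have VC : V `<=` commutative_ai_semiring by move=> S /VA/A_com.
apply: (satisfies_of_le TR6_com) => v p pt; apply: contrapT => npt; apply: nK;
  apply: (K_of_failing_le VA _ _ npt); try exact: words_neq_nil pt.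
- exact: (class_satisfies_le VC st).
- by apply: (class_satisfies_le VC _ pt) => S VS u; rewrite /= (st S VS u).
Qed.

(** * V(TR6) is not finitely based *)

(** Sets of vertices and edges of a graph stand for sums of words of length one
    and two; in [graph_algebra] the top element [None] stands for every sum with
    a word that is neither a vertex nor an edge.  Without the condition
    [vx_neq0] a product with an empty sum would break associativity. *)
Record subgraph (U : Type) : Type := Subgraph {
  vx : U -> Prop;
  ed : U * U -> Prop;
  vx_neq0 : vx !=set0 }.

Lemma setU_neq0l (U : Type) (A B : set U) : A !=set0 -> A `|` B !=set0.
Proof. by case=> x Ax; exists x; left. Qed.

Lemma subgraph_eq (U : Type) (X Y : subgraph U) :
  vx X = vx Y -> ed X = ed Y -> X = Y.
Proof.
case: X Y => a b h [c d k] /= ac bd; subst c d; congr Subgraph.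
exact: Prop_irrelevance.
Qed.

Section GraphAlgebra.
Variables (U : Type) (adj : U -> U -> Prop) (u0 : U).
Hypothesis adj_sym : forall x y, adj x y -> adj y x.
Hypothesis adj_irr : forall x, ~ adj x x.

Definition graph_add (x y : option (subgraph U)) : option (subgraph U) :=
  match x, y with
  | Some X, Some Y => Some (Subgraph (ed X `|` ed Y) (setU_neq0l (vx Y) (vx_neq0 X)))
  | _, _ => None
  end.

Definition joinable (X Y : subgraph U) : Prop :=
  [/\ ed X = set0, ed Y = set0 & forall x y, vx X x -> vx Y y -> adj x y].

Definition graph_mul (x y : option (subgraph U)) : option (subgraph U) :=
  match x, y with
  | Some X, Some Y => if pselect (joinable X Y) then
      Some (Subgraph (vx X `*` vx Y `|` vx Y `*` vx X)
                     (setU_neq0l (vx Y) (vx_neq0 X)))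
      else None
  | _, _ => None
  end.

Definition graph_algebra : algebra :=
  @Algebra (option (subgraph U)) graph_add graph_mul (inhabits None).

Lemma graph_mul_mul (x y z : graph_algebra) : alg_mul x (alg_mul y z) = None.
Proof.
case: x y z => [X|] [Y|] [Z|] //=; case: pselect => //= h.
case: pselect => //= -[_ e _].
have [y yY] := vx_neq0 Y; have [z zZ] := vx_neq0 Z.
have /= E := congr1 (fun A : U * U -> Prop => A (y, z)) e.
by suff : False by []; rewrite -[False]E; left.
Qed.

Lemma graph_algebra_com : commutative_ai_semiring graph_algebra.
Proof.
have addC : commutative graph_add.
  by move=> [X|] [Y|] //=; congr Some; apply: subgraph_eq; rewrite /= setUC.
have jC X Y : joinable X Y -> joinable Y X.
  by move=> [eX eY h]; split=> // x y xY yX; apply/adj_sym/h.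
have mulC : commutative graph_mul.
  move=> [X|] [Y|] //=; case: pselect => h; case: pselect => k //.
  - by congr Some; apply: subgraph_eq; rewrite /= setUC.
  - by case: k; apply: jC.
  - by case: h; apply: jC.
have mulDl : left_distributive graph_mul graph_add.
  move=> [X|] [Y|] [Z|] //=; do ?by case: pselect.
  case: pselect => [[eXY eZ h]|h].
    case: pselect => [k1|[]]; last first.
      split=> //; first by move: eXY; rewrite /= setU_eq0 => -[].
      by move=> x y xX; apply: h; left.
    case: pselect => [k2|[]]; last first.
      split=> //; first by move: eXY; rewrite /= setU_eq0 => -[].
      by move=> x y xX; apply: h; right.
    congr Some; apply: subgraph_eq => /=; first by rewrite setUACA setUid.
    apply/seteqP; split=> -[x y] /=; tauto.
  case: pselect => [[eX eZ k1]|] //=; case: pselect => [[eY _ k2]|] //=.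
  case: h; split=> //=; first by rewrite eX eY setU0.
  by move=> x y [/k1|/k2]; apply.
split=> //; split=> //.
- split=> //.
  + by move=> [X|] [Y|] [Z|] //=; congr Some; apply: subgraph_eq; rewrite /= setUA.
  + by move=> [X|] //=; congr Some; apply: subgraph_eq; rewrite /= setUid.
- by move=> x y z; rewrite graph_mul_mul -(graph_mul_mul z x y) [LHS]mulC.
- by move=> x y z; rewrite /= mulC mulDl !(mulC x).
Qed.

Lemma graph_algebra_A : variety_A graph_algebra.
Proof.
split; first exact: graph_algebra_com.
- move=> v /=; case: (v 0) (v 1) => [X|] [Y|] //=.
  case: pselect => [h|] //=; congr Some; apply: subgraph_eq => /=.
    by rewrite setUAC setUid.
  by case: h => -> _ _; rewrite setU0.
- have sqr x : graph_mul x x = None.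
    case: x => [X|] //=; case: pselect => //= -[_ _ h].
    by exfalso; have [x xX] := vx_neq0 X; apply: (adj_irr (h x x xX xX)).
  by move=> v /=; rewrite !sqr.
Qed.

Lemma graph_le_None (x : graph_algebra) : le x (None : graph_algebra).
Proof. by case: x. Qed.

Lemma graph_le_Some (x : graph_algebra) X : le x (Some X : graph_algebra) -> x <> None.
Proof. by move=> + x0; rewrite x0. Qed.

(** An inequality that fails at a valuation provides, by choosing
    a vertex in the value of every variable, a proper 2-colouring of the words
    of length two in its right side; this colouring gives a valuation in TR6,
    which sends one letter to 4, the other letters of its colour to 6, its
    neighbours to 5, and the other letters of the opposite colour to 2. *)
Lemma graph_algebra_satisfies (m : nat) s t :
  (forall f : nat -> U, exists col : nat -> bool, forall i j, i < m -> j < m ->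
     adj (f i) (f j) -> col i != col j) ->
  (forall k, k \in letters s -> k < m) -> (forall k, k \in letters t -> k < m) ->
  satisfies TR6 (s, t) -> satisfies graph_algebra (s, t).
Proof.
move=> bip.
suff main s' t' : (forall k, k \in letters s' -> k < m) -> satisfies TR6 (s', t') ->
    forall (v : nat -> graph_algebra) p, p \in words t' -> le (evalw v p) (eval v s').
  move=> sm tm st; apply: (satisfies_of_le graph_algebra_com) => v p; first exact: main.
  by apply: main => // w; rewrite /= (st w).
move=> {s t} sm st v p pt; apply: contrapT => np.
have AG := graph_algebra_A; have CG := A_com AG.
have below q : q \in words s' -> le (evalw v q) (eval v s') by apply: (evalw_le_eval CG).
case vs : (eval v s') => [Z|]; last by apply: np; rewrite vs; apply: graph_le_None.
have nN q : q \in words s' -> evalw v q <> None.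
  by move=> /below; rewrite vs; apply: graph_le_Some.
have /choice[pk pkE] (X : subgraph U) : exists x, vx X x by apply: vx_neq0.
pose f i := if v i is Some X then pk X else u0.
have [col colE] := bip f.
have lett q i : q \in words s' -> i \in q -> i \in letters s'.
  by move=> qs iq; apply/flattenP; exists q.
have s2 q : q \in words s' -> size q <= 2.
  move=> qs; rewrite leqNgt; apply/negP => q2; apply: (nN q qs).
  case: q q2 {qs} => [|i [|j [|k r]]] // _.
  by rewrite evalw_cons // evalw_cons // graph_mul_mul.
have edge i j : [:: i; j] \in words s' -> col i != col j.
  move=> ijs; apply: colE.
  - by apply/sm/(lett _ _ ijs)/mem_head.
  - by apply/sm/(lett _ _ ijs); rewrite !inE eqxx orbT.
  have := nN _ ijs; rewrite /= /f; case: (v i) => [X|] //; case: (v j) => [Y|] //=.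
  by case: pselect => // -[_ _ h] _; apply: h.
pose k := head 0 p.
pose inner i := has (fun q => (size q == 2) && (i \in q)) (words s').
pose nbr i := ([:: k; i] \in words s') || ([:: i; k] \in words s').
pose w i : TR6 := if i \notin letters s' then e1 else if ~~ inner i then e3 else
  if col i == col k then (if i == k then e4 else e6) else (if nbr i then e5 else e2).
have inner2 i j : [:: i; j] \in words s' -> inner i /\ inner j.
  by move=> ijs; split; apply/hasP; exists [:: i; j]; rewrite // !inE eqxx ?orbT.
have ws : le (eval w s') (e3 : TR6).
  apply/(eval_le TR6_com) => q qs; apply/TR6_le_e3.
  have := s2 q qs; have := words_neq_nil qs; case: q qs => [|i [|j [|]]] // qs _ _ /=.
    rewrite /w (lett _ i qs) ?mem_head //=; case: ifP => // _.
    by case: ifP => _; case: ifP.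
  have [ii jj] := inner2 i j qs; have cij := edge i j qs.
  rewrite /w (lett _ i qs) ?mem_head // (lett _ j qs) ?inE ?eqxx ?orbT //= ii jj /=.
  case: (col i =P col k) => ik; case: (col j =P col k) => jk.
  + by move: cij; rewrite ik jk eqxx.
  + case: (i =P k) => [ik'|_]; last by case: ifP.
    by rewrite /nbr -ik' qs.
  + case: (j =P k) => [jk'|_]; last by case: ifP.
    by rewrite /nbr -jk' qs orbT.
  + by move: cij ik jk; case: (col i) (col j) (col k) => [] [] [].
have wp : le (evalw w p) (e3 : TR6).
  apply: (le_trans TR6_com) ws; rewrite (st w).
  exact: (evalw_le_eval TR6_com).
move/TR6_le_e3: wp; apply; have pn := words_neq_nil pt.
have [ps|/allPn[j jp js]] := boolP (all (fun j => j \in letters s') p); last first.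
  have := letter_le TR6_A w jp; have -> : w j = e1 by rewrite /w js.
  by case: (evalw w p).
case pE : p pn np ps => [//|i [|j [|l r]]] _ np; last by move=> _; apply: TR6_long.
- rewrite /= andbT => /flattenP[q qs iq].
  by case: np; apply: (le_trans CG) (below q qs); apply: letter_le.
have kE : k = i by rewrite /k pE.
rewrite /= andbT => /andP[is' js']; rewrite /w is' js' /= kE !eqxx.
case: (inner i) => //=; case: (inner j) => //=; case: (col j == col i).
  by case: ifP.
case: ifP => // /orP[] h; case: np; first by apply: below; rewrite -kE.
have -> : evalw v [:: i; j] = evalw v [:: j; i] by exact: (mulsC CG).
by apply: below; rewrite -kE.
Qed.

End GraphAlgebra.

Section OddCycle.
Variable n : nat.
Hypothesis n_gt1 : 1 < n.

Definition cyc (i j : nat) : bool := [&& i < n, j < n &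
  [|| i.+1 == j, j.+1 == i, (i == n.-1) && (j == 0) | (j == n.-1) && (i == 0)]].

Lemma cyc_sym i j : cyc i j -> cyc j i.
Proof. by rewrite /cyc => /and3P[-> -> /or4P[->|->|->|->]]; rewrite ?orbT. Qed.

Lemma cyc_irr i : ~ cyc i i.
Proof.
rewrite /cyc => /and3P[_ _].
by rewrite !(gtn_eqF (ltnSn _)) /= orbb => /andP[/eqP-> /eqP]; case: n n_gt1 => [|[]].
Qed.

(** Colour by the parity of the distance from [u] in one direction: this distance
    changes by one along every edge that avoids [u]. *)
Lemma cyc_remove u : u < n -> exists col : nat -> bool, forall i j,
  i != u -> j != u -> cyc i j -> col i != col j.
Proof.
move=> un; pose col i := odd (if u < i then i - u else i + n - u).
exists col; suff step i j : i != u -> j != u -> i < n -> j < n ->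
    (i.+1 == j) || (i == n.-1) && (j == 0) -> col i != col j.
  move=> i j iu ju /and3P[i_n j_n] /or4P[] h.
  - by apply: step; rewrite ?h.
  - by rewrite eq_sym; apply: step; rewrite ?h.
  - by apply: step; rewrite ?h ?orbT.
  - by rewrite eq_sym; apply: step; rewrite ?h ?orbT.
move=> iu ju i_n j_n /orP[/eqP E|/andP[/eqP iE /eqP jE]]; rewrite /col.
  subst j; case: (ltngtP u i) => ui; last by rewrite ui eqxx in iu.
    by rewrite ltnS (ltnW ui) subSn ?(ltnW ui) //=; case: odd.
  rewrite ltnNge ui /= addSn subSn /=; first by case: odd.
  by apply: leq_trans (ltnW un) _; rewrite leq_addl.
subst i j; rewrite ltn0 add0n; have un1 : u < n.-1.
  by rewrite ltn_neqAle eq_sym iu -ltnS prednK // (ltn_trans _ n_gt1).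
rewrite un1; have -> : n - u = (n.-1 - u).+1.
  by rewrite -subSn ?prednK // ?(ltnW un1) // (ltn_trans _ n_gt1).
by rewrite /=; case: odd.
Qed.

Lemma cyc_bipartite m (f : nat -> nat) : m < n -> exists col : nat -> bool,
  forall i j, i < m -> j < m -> cyc (f i) (f j) -> col i != col j.
Proof.
move=> mn; have [u un uf] : exists2 u, u < n & u \notin [seq f i | i <- iota 0 m].
  apply: contrapT => h; have : n <= m.
    rewrite -(size_iota 0 n) -(size_iota 0 m) -(size_map f (iota 0 m)).
    apply: uniq_leq_size (iota_uniq 0 n) _ => u; rewrite mem_iota add0n /= => un.
    by apply/negPn/negP => uf; apply: h; exists u.
  by rewrite leqNgt mn.
have [col colE] := cyc_remove un; exists (col \o f) => i j im jm.
have fu k : k < m -> f k != u.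
  move=> km; apply: contraNneq uf => <-; apply: map_f.
  by rewrite mem_iota.
by apply: colE; apply: fu.
Qed.

Definition cycle_words : seq (seq nat) :=
  [:: n.-1; 0] :: [seq [:: i; i.+1] | i <- iota 0 n.-1].

(** The word 0 0 is a square, whose value is the top both in TR6 and in the
    algebra of the cycle: the identity says that the sum of the edges of the
    cycle is the top. *)
Definition cycle_identity : identity :=
  (sum_words cycle_words, Add (sum_words cycle_words) (wterm [:: 0; 0])).

Lemma cycle_wordsP p : p \in cycle_words -> exists i j, p = [:: i; j] /\ cyc i j.
Proof.
have n0 : 0 < n by apply: ltn_trans n_gt1.
rewrite inE => /predU1P[->|/mapP[i + ->]].
  exists n.-1, 0; split=> //; rewrite /cyc n0 !eqxx /= !orbT andbT.
  by rewrite prednK.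
rewrite mem_iota add0n /= => i_n; exists i, i.+1; split=> //.
have i1 : i.+1 < n by rewrite -(prednK n0) ltnS.
by rewrite /cyc i1 (ltnW i1) eqxx.
Qed.

(** In TR6 a product different from 1 has one factor in the set of 4 and 6 and
    the other in the set of 2 and 5; on an odd cycle this is impossible. *)
Lemma TR6_cycle : odd n -> satisfies TR6 cycle_identity.
Proof.
move=> no v; rewrite /cycle_identity; set c := sum_words cycle_words.
have [c1|cle] := TR6_e1_or_le (eval v c); first by rewrite /= c1.
have cn : cycle_words <> [::] by [].
have h := (sum_words_le v e3 TR6_com cn).1 cle.
pose side (x : TR6) := match x with e4 | e6 => true | _ => false end.
have hs i j : [:: i; j] \in cycle_words -> side (v j) = ~~ side (v i).
  by move=> /h /TR6_le_e3 /=; case: (v i) (v j) => [] [].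
have sideE i : i < n -> side (v i) = side (v 0) (+) odd i.
  elim: i => [|i IH] i_n; first by rewrite addbF.
  rewrite (hs i) ?IH ?(ltnW i_n) //= ?addbN // inE; apply/orP; right.
  by rewrite (map_f (fun i => [:: i; i.+1])) // mem_iota add0n /= -ltnS prednK // (ltn_trans _ n_gt1).
have n0 : 0 < n by apply: ltn_trans n_gt1.
have := hs n.-1 0 (mem_head _ _); rewrite (sideE n.-1) ?prednK //.
have -> : odd n.-1 = false by move: no; rewrite -{1}(prednK n0) /= => /negbTE.
by rewrite addbF; case: (side _).
Qed.

Lemma graph_not_cycle : ~ satisfies (graph_algebra cyc) cycle_identity.
Proof.
have CG := graph_algebra_com cyc_sym.
have ne (i : nat) : [set i] !=set0 by exists i.
pose v i : graph_algebra cyc := Some (Subgraph set0 (ne i)).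
pose top : graph_algebra cyc := Some (Subgraph setT (setU_neq0l setT (ne 0))).
have vE i j : cyc i j -> evalw v [:: i; j] <> None.
  move=> ij /=; case: pselect => //= -[]; split=> //.
  by move=> x y -> ->.
have cn : cycle_words <> [::] by [].
have ctop : le (eval v (sum_words cycle_words)) top.
  apply/(sum_words_le _ _ CG cn) => p /cycle_wordsP[i [j [-> /vE]]].
  case: (evalw v _) => // X _; congr Some; apply: subgraph_eq => /=.
    by rewrite !setUT.
  by rewrite setUT.
move=> /(_ v); rewrite /cycle_identity; move: ctop.
set c := sum_words cycle_words => ctop /= cE; move: ctop; rewrite cE.
case: pselect => [[_ _ h]|_] /=; first by case: (cyc_irr (h 0 0 erefl erefl)).
by case: (eval v c).
Qed.
End OddCycle.

Lemma finite_identities_bounded (E : set identity) : finite_set E ->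
  exists m, forall e, E e -> forall k, k \in letters e.1 ++ letters e.2 -> k < m.
Proof.
move=> fE; pose b (e : identity) := \max_(k <- letters e.1 ++ letters e.2) k.
have /finite_seqP[l lE] : finite_set (b @` E) by apply: finite_image.
exists (\max_(k <- l) k).+1 => e Ee k ke; rewrite ltnS.
apply: (@leq_trans (b e)); first by apply: (leq_bigmax_seq (F := id)).
apply: (leq_bigmax_seq (F := id)) => //.
have : (b @` E) (b e) by exists e.
by rewrite lE.
Qed.

(** Finitely many identities of TR6 cannot detect a cycle longer than the number
    of their variables. *)
Lemma TR6_not_finitely_based : ~ finitely_based (generated_variety TR6).
Proof.
move=> [E [fE VE]]; have [m mE] := finite_identities_bounded fE.
(* An odd length above [m]. *)
pose n := m.*2.+3; have n_gt1 : 1 < n by [].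
have mn : m < n by rewrite /n ltnS -addnn -!addnS leq_addr.
have : generated_variety TR6 (graph_algebra (cyc n)).
  rewrite VE => -[s t] Ee.
  apply: (graph_algebra_satisfies 0 (@cyc_sym n) (cyc_irr n_gt1) (m := m)).
  - by move=> f; apply: cyc_bipartite.
  - by move=> k ks; apply: (mE _ Ee); rewrite mem_cat ks.
  - by move=> k kt; apply: (mE _ Ee); rewrite mem_cat kt orbT.
  - by have := @mem_generated TR6; rewrite VE => /(_ _ Ee).
move=> /(generated_satisfies (TR6_cycle n_gt1 _)) h; apply: (graph_not_cycle n_gt1).
by apply: h; rewrite /n /= odd_double.
Qed.

(** * The limit variety V(TR6) *)

Lemma N_A : variety_A N_max_plus.
Proof.
have le_max (a b : nat) : a <= b -> maxn b a = b by move/maxn_idPl.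
split; first split.
- split; last by move=> x y z /=; rewrite addn_maxr.
  + split; [exact: maxnA|exact: maxnC|exact: maxnn].
  + exact: addnA.
  + by move=> x y z /=; rewrite addn_maxl.
- exact: addnC.
- by move=> v /=; rewrite le_max // leq_addr.
- move=> v /=; rewrite le_max // leq_max; case: (leqP (v 0) (v 1)) => h.
    by rewrite leq_add2r h orbT.
  by rewrite leq_add2l (ltnW h).
Qed.

Lemma N_not_K : ~ satisfies N_max_plus K_identity.
Proof. by move=> /(_ (nth 0 [:: 0; 1; 0; 0; 1])). Qed.


Lemma hereditarily_finitely_based_iff_K (V : set algebra) : subvariety V variety_A ->
  class_satisfies V K_identity <-> hereditarily_finitely_based V.
Proof.
move=> [vV VA]; split=> [VK W [vW WV]|hV].
  have [|E [WE _]] := @subvariety_K_finite_basis W; last by exists E.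
  by split=> // S /WV VS; split; [exact: VA|exact: VK].
apply: K_of_not_TR6 => // VTR6; apply: TR6_not_finitely_based; apply: hV.
by split; [exact: variety_generated|exact: generated_sub].
Qed.

Lemma not_TR6_iff_K (V : set algebra) : subvariety V variety_A ->
  ~ V TR6 <-> class_satisfies V K_identity.
Proof.
move=> VA; split=> [|VK VTR6]; first exact: K_of_not_TR6.
exact/TR6_not_K/VK.
Qed.

Lemma finitely_based_of_not_TR6 (V : set algebra) : subvariety V variety_A ->
  ~ V TR6 -> finitely_based V.
Proof.
move=> VA nV; have [vV _] := VA.
have /(hereditarily_finitely_based_iff_K VA) : class_satisfies V K_identity.
  by apply/not_TR6_iff_K.
by apply; split.
Qed.

Lemma limit_TR6 : limit_variety (generated_variety TR6).
Proof.
split; [exact: variety_generated|exact: TR6_not_finitely_based|].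
move=> W [vW WT] nW; apply: finitely_based_of_not_TR6.
  by split=> // S /WT; apply: generated_A; apply: TR6_A.
by move=> WTR6; apply: nW; apply/seteqP; split=> //; apply: generated_sub.
Qed.

Lemma unique_limit (V : set algebra) : V `<=` variety_A -> V TR6 -> variety V ->
  unique_limit_subvariety V (generated_variety TR6).
Proof.
move=> VA VT vV U; split=> [[[vU UV] [_ nU hU]]|->]; last first.
  by split; [split; [exact: variety_generated|exact: generated_sub]|exact: limit_TR6].
have UA : subvariety U variety_A by split=> // S /UV/VA.
have UT : U TR6 by apply: contrapT => /(finitely_based_of_not_TR6 UA).
apply: contrapT => nUT; apply: TR6_not_finitely_based; apply: hU.
  by split; [exact: variety_generated|exact: generated_sub].
by move=> e; apply: nUT; rewrite e.
Qed.

Lemma variety_variety_A : variety variety_A.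
Proof.
have -> : variety_A = models (range A_axiom).
  apply/seteqP; split=> S; first by move=> /A_axiomP h _ [i _ <-].
  by move=> h; apply/A_axiomP => i; apply: h; exists i.
exact: variety_models.
Qed.

Theorem theorem1p1 :
  (forall V : set algebra, subvariety V variety_A ->
     (~ V TR6 <-> class_satisfies V K_identity) /\
     (class_satisfies V K_identity <-> hereditarily_finitely_based V)) /\
  finite_set [set W | subvariety W variety_K] /\
  (forall W : set algebra, subvariety W variety_K ->
     exists E : set identity, finite_basis W E /\ (vars E #<= `I_10)%card) /\
  unique_limit_subvariety variety_A (generated_variety TR6) /\
  unique_limit_subvariety variety_M (generated_variety TR6).
Proof.
split=> [V VA|].
  by split; [exact: not_TR6_iff_K|exact: hereditarily_finitely_based_iff_K].
split; first exact: finite_subvarieties_K.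
split; first exact: subvariety_K_finite_basis.
split; first by apply: unique_limit => //; [exact: TR6_A|exact: variety_variety_A].
have MA : variety_M `<=` variety_A by apply: generated_A; apply: N_A.
have vM : variety variety_M by apply: variety_generated.
apply: unique_limit => //; apply: contrapT => /(K_of_not_TR6 (conj vM MA)) MK.
by apply: N_not_K; apply: MK; apply: mem_generated.
Qed.
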